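(* Let $K$ and $K'$ be two compact convex sets. The following statements are equivalent: (1) There exists a gauge-preserving bijection $\Phi : A_c(K) \to A_c(K')$ such that $\Phi(\mathbb{1}_K) = \mathbb{1}_{K'}$. (2) There exists a bijection $\alpha : \partial_e K \to \partial_e K'$ such that for every $f \in A_c(K)$ and $g \in A_c(K')$, the functions $g \circ \alpha : \partial_e K \to (0,\infty)$ and $f \circ \alpha^{-1} : \partial_e K' \to (0,\infty)$ are continuous and admit continuous affine extensions to $K$ and $K'$, respectively. Moreover, when these equivalent conditions hold, $\Phi$ and its inverse are completely determined on the extreme boundaries by $$\Phi(f)|_{\partial_e K'} = f \circ \alpha^{-1} \ \text{ for every } f \in A_c(K), \qquad \Phi^{-1}(g)|_{\partial_e K} = g \circ \alpha \ \text{ for every } g \in A_c(K');$$ that is, for every $\Phi$ as in (1) there is an $\alpha$ as in (2) satisfying these formulas, and for every $\alpha$ as in (2) there is a $\Phi$ as in (1) satisfying them.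
   Context: A compact convex set $K$ is a nonempty compact convex subset of a Hausdorff locally convex space; $\partial_e K$ is its set of extreme points with the relative topology. $A(K)$ is the space of real-valued continuous affine functions on $K$, $A_c(K) = \{f \in A(K) : f(x) > 0 \text{ for all } x \in K\}$, and $\mathbb{1}_K$ is the constant function $1$ on $K$. For $f,g \in A_c(K)$ put $m(f,g) = \sup\{\lambda > 0 : \lambda g \le f\}$ and $M(f,g) = \inf\{\mu > 0 : f \le \mu g\}$ (pointwise order). A bijection $\Phi : A_c(K) \to A_c(K')$ is gauge-preserving if $M(\Phi(f),\Phi(g)) = M(f,g)$ for all $f,g \in A_c(K)$ (equivalently $m(\Phi(f),\Phi(g)) = m(f,g)$). *)

(* Defs.v *)
From mathcomp Require Import all_boot all_order all_algebra.
From mathcomp Require Import all_classical all_reals all_analysis.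

Set Implicit Arguments.
Unset Strict Implicit.
Unset Printing Implicit Defensive.

Import Order.TTheory GRing.Theory Num.Theory.
Import numFieldNormedType.Exports.

Local Open Scope classical_set_scope.
Local Open Scope ring_scope.
Local Open Scope convex_scope.

(* Sets are used as types throughout: for [K : set E], a function on [K] is a
   function on the subtype [set_type K], which carries the relative topology. *)

Section Defs.
Context {R : realType} {E : tvsType R}.
Implicit Type K : set E.

Definition compact_convex_set K : Prop :=
  [/\ hausdorff_space E, K !=set0, compact K & convex_set K].

Definition is_conv_comb K (t : {i01 R}) (x y z : K) : Prop :=
  \val z = (\val x : convex_lmodType E) <| t |> \val y.

(* A subset of [set_type K] rather than of [E], so that the restriction to it
   of a function on [K] is the library's [sigL]. *)
Definition extreme_boundary K : set K :=
  [set x | forall (y z : K) (t : {i01 R}), 0 < t%:num -> t%:num < 1 ->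
    is_conv_comb t y z x -> y = x /\ z = x].
Arguments extreme_boundary : clear implicits.

Definition affine K (f : K -> R) : Prop :=
  forall (t : {i01 R}) (x y z : K), is_conv_comb t x y z ->
    f z = (f x : convex_lmodType R^o) <| t |> f y.

Definition A K : set (K -> R) := [set f | continuous f /\ affine f].
Arguments A : clear implicits.

Definition Ac K : set (K -> R) := [set f | A K f /\ forall x, 0 < f x].
Arguments Ac : clear implicits.

Lemma Ac_cst1 K : Ac K (cst 1).
Proof.
split=> [|x]; last exact: ltr01.
split; first exact: cst_continuous.
by move=> t x y z _; rewrite convmm.
Qed.

Definition oneAc K : Ac K := SigSub (mem_set (@Ac_cst1 K)).

(* For [f, g] in A_c(K) with [K] compact and nonempty, the set is nonempty and
   bounded below, so that the total function [inf] is the actual infimum. *)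
Definition gaugeM K (f g : Ac K) : R :=
  inf [set mu : R | 0 < mu /\ forall x : K, \val f x <= mu * \val g x].

Definition continuously_affinely_extendable K (h : extreme_boundary K -> R) :=
  continuous h /\ exists2 F : K -> R, A K F & sigL (extreme_boundary K) F = h.

End Defs.

Arguments extreme_boundary {R E} K.
Arguments A {R E} K.
Arguments Ac {R E} K.
Arguments oneAc {R E} K.

Section Maps.
Context {R : realType} {E E' : tvsType R} (K : set E) (K' : set E').

Definition inverse_bijections (X Y : Type) (f : X -> Y) (g : Y -> X) : Prop :=
  cancel f g /\ cancel g f.

Definition gauge_preserving (Phi : Ac K -> Ac K') : Prop :=
  forall f g : Ac K, gaugeM (Phi f) (Phi g) = gaugeM f g.

Definition unital_gauge_bijection
    (Phi : Ac K -> Ac K') (Phiinv : Ac K' -> Ac K) : Prop :=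
  [/\ inverse_bijections Phi Phiinv, gauge_preserving Phi &
      Phi (oneAc K) = oneAc K'].

Definition boundary_restriction (f : Ac K) : extreme_boundary K -> R :=
  sigL (extreme_boundary K) (\val f).

End Maps.

Section BoundaryMaps.
Context {R : realType} {E E' : tvsType R} (K : set E) (K' : set E').

Definition affine_boundary_bijection
    (alpha : extreme_boundary K -> extreme_boundary K')
    (alphainv : extreme_boundary K' -> extreme_boundary K) : Prop :=
  inverse_bijections alpha alphainv /\
  forall (f : Ac K) (g : Ac K'),
    continuously_affinely_extendable (boundary_restriction g \o alpha) /\
    continuously_affinely_extendable (boundary_restriction f \o alphainv).

Definition determined_on_boundary
    (Phi : Ac K -> Ac K') (Phiinv : Ac K' -> Ac K)
    (alpha : extreme_boundary K -> extreme_boundary K')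
    (alphainv : extreme_boundary K' -> extreme_boundary K) : Prop :=
  (forall f : Ac K,
     boundary_restriction (Phi f) = boundary_restriction f \o alphainv) /\
  (forall g : Ac K',
     boundary_restriction (Phiinv g) = boundary_restriction g \o alpha).

End BoundaryMaps.

(* Main.v *)
(* Call a set [D] of functions directed when any two of its members lie below a
   third.  Two facts about a compact convex set [K] carry the argument.
   (a) For [x] extreme, [{f in A_c(K) | f x < 1}] is directed: [x] lies on no
       proper chord, so above [x] the convex hull of the hypographs of [f1] and
       [f2] stays below 1, and Hahn-Banach gives an affine [g >= f1, f2] with
       [g x < 1].
   (b) If [D] is directed, contains the constants in (0, 1), and each of its
       members is <= 1 somewhere, then the set of points where every member of
       [D] is <= 1 is nonempty by compactness and extremal, so it contains an
       extreme point by the Krein-Milman argument.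
   A gauge-preserving bijection [Phi] with [Phi 1 = 1] is an order isomorphism
   commuting with positive scalars.  It carries the family of (a) to a family as
   in (b), hence for [x] extreme there is [x'] extreme with
   [Phi f x' <= f x] for all [f].  The same for [Phi^-1] gives [x''] with
   [f x'' <= Phi f x' <= f x] for all [f]; as A(K) separates points, [x'' = x]
   and [Phi f x' = f x].  Linearity of [Phi] is never needed.  The converse is
   the minimum principle for continuous affine functions. *)
Require Import Defs.
From mathcomp Require Import all_boot all_order all_algebra.
From mathcomp Require Import all_classical all_reals all_analysis.
From mathcomp Require Import ring lra.
Import Order.TTheory GRing.Theory Num.Theory.
Import numFieldNormedType.Exports.
Set Implicit Arguments.
Unset Strict Implicit.
Unset Printing Implicit Defensive.
Local Open Scope classical_set_scope.
Local Open Scope ring_scope.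
Local Open Scope convex_scope.

(** * Hahn-Banach for convex cones *)

Section HahnBanach.
Context {R : realType} {V : lmodType R}.
Implicit Types N : set (V * R^o)%type.

Definition convex_cone {W : lmodType R} (N : set W) : Prop :=
  (forall v w, N v -> N w -> N (v + w)) /\
  (forall c v, 0 <= c -> N v -> N (c *: v)).

(** Over 0 the cone contains no point below the origin. When [(v, r)] and [(- v, s)] both lie in the
    cone, adding them gives [- s <= r], so a point over [- v] bounds the fibre over [v] from
    below. *)
Definition nonneg_over0 N : Prop := forall r, N (0, r) -> 0 <= r.

(** Zorn's lemma applies because each condition involves at most two points at a time, and two
    points of the union of a chain lie in a common member. *)
Lemma maximal_cone N0 : convex_cone N0 -> nonneg_over0 N0 ->
  exists N, [/\ N0 `<=` N, convex_cone N, nonneg_over0 N &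
    forall N', N `<=` N' -> convex_cone N' -> nonneg_over0 N' -> N' `<=` N].
Proof.
move=> cN0 pN0.
(* Adjoining [N0] inside [P] makes the union of the empty chain admissible. *)
pose P N := convex_cone (N `|` N0) /\ nonneg_over0 (N `|` N0).
have [F FP Ftot|N [[cN pN] Nmax]] := @Zorn_bigcup _ P.
  have [[X0 FX0]|F0] := pselect (F !=set0); last first.
    have -> : \bigcup_(X in F) X = set0.
      by rewrite -subset0 => v [X FX _]; apply: F0; exists X.
    by rewrite /P set0U.
  have both v w : (\bigcup_(X in F) X `|` N0) v ->
      (\bigcup_(X in F) X `|` N0) w ->
      exists2 X, F X & (X `|` N0) v /\ (X `|` N0) w.
    move=> [[X FX Xv]|Nv] [[Y FY Yw]|Nw].
    - have [XY|YX] := Ftot _ _ FX FY.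
      + by exists Y => //; split; left => //; exact: XY.
      + by exists X => //; split; left => //; exact: YX.
    - by exists X => //; split; [left|right].
    - by exists Y => //; split; [right|left].
    - by exists X0 => //; split; right.
  have sub X : F X -> X `|` N0 `<=` \bigcup_(X in F) X `|` N0.
    by move=> FX v [Xv|Nv]; [left; exists X|right].
  split; first split.
  - move=> v w Fv Fw; have [X FX [Xv Xw]] := both _ _ Fv Fw.
    by apply: (sub _ FX); have [[+ _] _] := FP _ FX; exact.
  - move=> c v c0 Fv; have [X FX [Xv _]] := both _ _ Fv Fv.
    by apply: (sub _ FX); have [[_ +] _] := FP _ FX; exact.
  - move=> r Fr; have [X FX [Xr _]] := both _ _ Fr Fr.
    by have [_] := FP _ FX; exact.
exists (N `|` N0); split => //.
move=> N' NN' cN' pN'; apply: contrapT => N'N.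
apply: (Nmax N'); last first.
  have N0N' : N0 `<=` N' by move=> v N0v; apply: NN'; right.
  by rewrite /P setUidl.
split; first by move=> v Nv; apply: NN'; left.
by move=> N'N2; apply: N'N => v /N'N2; left.
Qed.

(* A maximal cone is a half-space whose boundary is the graph of [l]. *)
Lemma cone_supporting_linear N : convex_cone N -> nonneg_over0 N ->
  (forall v, exists r, N (v, r)) ->
  exists2 l : V -> R, linear (l : V -> R^o) & forall v r, N (v, r) -> l v <= r.
Proof.
move=> cN0 pN0 tN0; have [M [N0M [addM scaleM] pM maxM]] := maximal_cone cN0 pN0.
have totM v : exists r, M (v, r).
  by have [r /N0M Mr] := tN0 v; exists r.
have M0 : M 0 by have [r Mr] := totM 0; rewrite -(scale0r (0, r)); exact: scaleM.
have below v r s : M (v, r) -> M (- v, s) -> - s <= r.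
  move=> Mr Ms; have := addM _ _ Mr Ms.
  by rewrite -[_ + _]/(v - v, r + s) subrr => /pM; rewrite -lerBlDr sub0r.
(* If [(v, r)] is missing, the cone generated by [M] and [(v, r)] is strictly larger, so by
   maximality it contains a point below 0 over 0. Rescaled, that point yields the required
   [(- v, s)]. *)
have ext v r : ~ M (v, r) -> exists2 s, M (- v, s) & s < - r.
  move=> Mvr; apply: contrapT => noext; apply: Mvr.
  pose M' := [set w | exists w', exists2 c : R,
    M w' /\ 0 <= c & w = w' + c *: (v, r : R^o)].
  apply: (maxM M').
  - by move=> w Mw; exists w; exists 0; rewrite ?scale0r ?addr0.
  - split.
    + move=> _ _ [w1 [c1 [Mw1 c10] ->]] [w2 [c2 [Mw2 c20] ->]].
      exists (w1 + w2); exists (c1 + c2); last by rewrite addrACA scalerDl.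
      by split; [exact: addM|exact: addr_ge0].
    + move=> c _ c0 [w [d [Mw d0] ->]]; exists (c *: w); exists (c * d).
        by split; [exact: scaleM|exact: mulr_ge0].
      by rewrite scalerDr scalerA.
  - move=> s [[w t]] [c [Mwt c0]] [].
    move=> /eqP; rewrite eq_sym addr_eq0 => /eqP wE ->.
    move: c0; rewrite le_eqVlt => /predU1P[c0|c0].
      by move: Mwt; rewrite wE -c0 !scale0r oppr0 addr0 => /pM.
    rewrite leNgt; apply/negP => tc; apply: noext.
    exists (c^-1 * t).
      rewrite -[(_, _)]/(- v, c^-1 *: (t : R^o)).
      have -> : - v = c^-1 *: w.
        by rewrite wE scalerN scalerA mulVf ?gt_eqF// scale1r.
      by apply: (scaleM c^-1 (w, t)) => //; rewrite invr_ge0 ltW.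
    rewrite mulrC ltr_pdivrMr// mulNr -subr_lt0 opprK [r * c]mulrC.
    exact: tc.
  - by exists 0; exists 1 => //; rewrite scale1r add0r.
pose S v := [set r | M (v, r : R^o)].
have Slb v : has_lbound (S v).
  by have [s Ms] := totM (- v); exists (- s) => r /= Mr; exact: below Ms.
have S0 v : S v !=set0 by exact: totM.
pose l v : R := inf (S v).
have l_le v r : M (v, r) -> l v <= r by move=> Mr; exact: ge_inf.
have l_ge v x : (forall r, M (v, r) -> x <= r) -> x <= l v.
  by move=> xr; exact: lb_le_inf.
(* Maximality enters here: the point at height [l v - e] lies below the fibre over [v], so [ext]
   gives a point over [- v] at height less than [- l v + e]. Being odd and sublinear, [l] is
   linear. *)
have lN v : l (- v) = - l v.
  apply/eqP; rewrite eq_le; apply/andP; split; last first.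
    apply: (l_ge) => s Ms; rewrite lerNl; apply: (l_ge) => r Mr.
    exact: below Ms.
  rewrite lerNr; apply/ler_addgt0Pr => e e0.
  have [] := ext v (l v - e).
    by move=> /l_le; rewrite lerBrDl gerDr leNgt e0.
  move=> s /l_le ls s_lt.
  have := le_lt_trans ls s_lt; lra.
have l_sub v w : l (v + w) <= l v + l w.
  rewrite -lerBlDr; apply: (l_ge) => r Mr; rewrite lerBlDl -lerBlDr.
  apply: (l_ge) => s Ms; rewrite lerBlDr [s + r]addrC.
  by apply: l_le; exact: (addM _ _ Mr Ms).
have lD v w : l (v + w) = l v + l w.
  apply/eqP; rewrite eq_le l_sub/=.
  have := l_sub (- v) (- w); rewrite -opprD !lN; lra.
have lZ_le c v : 0 < c -> l (c *: v) <= c * l v.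
  move=> c0; rewrite -ler_pdivrMl//; apply: (l_ge) => r Mr.
  by rewrite ler_pdivrMl//; apply: l_le; exact: (scaleM _ _ (ltW c0) Mr).
have lZp c v : 0 < c -> l (c *: v) = c * l v.
  move=> c0; apply/eqP; rewrite eq_le lZ_le//=.
  have := @lZ_le c^-1 (c *: v); rewrite invr_gt0 c0 scalerA mulVf ?gt_eqF//.
  by rewrite scale1r => /(_ isT); rewrite ler_pdivlMl.
exists l; last by move=> v r /N0M /l_le.
move=> c v w; rewrite lD; congr (_ + _).
have [c0|c0|->] := ltgtP c 0.
- by rewrite -[c]opprK scaleNr lN lZp ?oppr_gt0// -mulNr.
- exact: lZp.
- rewrite !scale0r; have := lN 0; rewrite oppr0; lra.
Qed.

End HahnBanach.

(** * Locally convex spaces *)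

Lemma convex_set_conv {R : realType} {V : lmodType R} (U : set V) s t v w :
  convex_set (U : set (convex_lmodType V)) -> 0 <= s -> 0 <= t -> s + t = 1 ->
  U v -> U w -> U (s *: v + t *: w).
Proof.
move=> cU s0 t0 st Uv Uw.
have s1 : s <= 1 by rewrite -st lerDl.
have := cU v w (Itv01 s0 s1) (mem_set Uv) (mem_set Uw).
rewrite inE; congr (U _); congr (_ + _ *: _).
by rewrite -[LHS]/(1 - s) -st addrAC subrr add0r.
Qed.

(** Convexity with unnormalised weights, allowing [s + t = 0]. This is the form needed to add two
    elements of the cone generated by [U]. *)
Lemma convex_set_scaled {R : realType} {V : lmodType R} (U : set V) s t v w :
  convex_set (U : set (convex_lmodType V)) -> 0 <= s -> 0 <= t ->
  U v -> U w -> exists2 u, U u & s *: v + t *: w = (s + t) *: u.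
Proof.
move=> cU s0 t0 Uv Uw.
have := addr_ge0 s0 t0; rewrite le_eqVlt => /predU1P[st|st].
  have [-> ->] : s = 0 /\ t = 0 by split; lra.
  by exists v => //; rewrite addr0 !scale0r addr0.
exists ((s / (s + t)) *: v + (t / (s + t)) *: w).
  apply: convex_set_conv => //; [exact: divr_ge0 (ltW _)|exact: divr_ge0 (ltW _)|].
  by rewrite -mulrDl divff// gt_eqF.
by rewrite scalerDr !scalerA mulrC divfK ?gt_eqF// mulrC divfK ?gt_eqF.
Qed.

Lemma linear_at0 {R : realType} {V : lmodType R} (l : V -> R) :
  linear (l : V -> R^o) -> l 0 = 0.
Proof.
by move=> linl; have := linl (-1) 0 0; rewrite scaler0 addr0 scaleN1r addNr.
Qed.

Lemma convex_set_shrink {R : realType} {V : lmodType R} (U : set V) c v :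
  convex_set (U : set (convex_lmodType V)) -> U 0 -> 0 <= c <= 1 -> U v ->
  U (c *: v).
Proof.
move=> cU U0 /andP[c0 c1] Uv; rewrite -[_ *: _]addr0 -(scaler0 _ (1 - c)).
by apply: convex_set_conv; rewrite ?subr_ge0// addrC subrK.
Qed.

Section LocallyConvex.
Context {R : realType} {E : tvsType R}.
Implicit Types (U : set E) (l : E -> R).

Lemma convex_nbhs0 U : nbhs 0 U ->
  exists2 V, nbhs 0 V & convex_set (V : set (convex_lmodType E)) /\ V `<=` U.
Proof.
move=> U0; have [B Bconv [Bo Bb]] := @locally_convex R E.
have [V [BV V0] VU] := Bb 0 _ U0.
exists V; first by apply: open_nbhs_nbhs; split => //; exact: Bo.
by split => //; apply: Bconv; exact/mem_set.
Qed.

Lemma nbhs0_absorbing U u : nbhs 0 U -> exists2 s, 0 < s & U (s *: u).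
Proof.
move=> U0; have := @scale_continuous R E (0, u) U.
rewrite /= scale0r => /(_ U0)[[B1 B2] [/= B1n B2n] BU].
have [e e0 eB] := B1n.
exists (e / 2); first by rewrite divr_gt0.
apply: (BU (e / 2, u)); split => /=; last exact: nbhs_singleton.
apply: eB; rewrite /= sub0r normrN ger0_norm ?divr_ge0 ?ltW//.
by rewrite ltr_pdivrMr// ltr_pMr// ltr1n.
Qed.

(** The bound is two-sided on the intersection of [U] and [- U], and scaling that neighbourhood
    makes the oscillation of [l] arbitrarily small. *)
Lemma linear_bounded_continuous U l M : nbhs 0 U -> linear (l : E -> R^o) ->
  (forall u, U u -> l u <= M) -> continuous (l : E -> R).
Proof.
move=> U0 linl lM x.
have lB u v : l (u - v) = l u - l v.
  by have := linl (-1) v u; rewrite !scaleN1r ![- v + _]addrC ![- l v + _]addrC.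
have l0 : l 0 = 0 by rewrite -(subrr 0) lB subrr.
have lN u : l (- u) = - l u by rewrite -sub0r lB l0 sub0r.
have lZ c u : l (c *: u) = c * l u.
  by have := linl c u 0; rewrite !addr0 l0 => ->; rewrite addr0.
have M0 : 0 <= M by rewrite -l0; apply: lM; exact: nbhs_singleton.
apply/(@cvgrPdist_lt _ R^o) => e e0.
(* [M] may be 0, so the scaling factor is [e / (M + 1)]. *)
have M1 : 0 < M + 1 by rewrite ltr_wpDl.
have c0 : 0 < e / (M + 1) by rewrite divr_gt0.
have UN : nbhs 0 (U `&` [set - x | x in U]).
  by apply: filterI => //; exact: nbhs0N.
have := nbhsT x (nbhs0Z (lt0r_neq0 c0) UN).
apply: filterS => _ [_ [u [Uu [v Uv vu]] <-] <-].
rewrite -lB opprD addrA subrr sub0r lN normrN lZ normrM gtr0_norm//.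
rewrite -mulrA gtr_pMr// mulrC ltr_pdivrMr// mul1r.
apply: (@le_lt_trans _ _ M); last by rewrite ltrDl.
by rewrite ler_norml lM// andbT -vu lN lerN2 lM.
Qed.

(* Hahn-Banach below the gauge of [U]: the hypothesis on [H] says that
   [v <= M * p d] on [H], where [p] is the Minkowski functional of [U]. *)
Lemma continuous_linear_majorant U (H : set (E * R^o)%type) M :
  nbhs 0 U -> convex_set (U : set (convex_lmodType E)) ->
  convex_cone H -> H 0 ->
  (forall s w v, 0 <= s -> U w -> H (s *: w, v) -> v <= M * s) ->
  exists l, [/\ linear (l : E -> R^o), continuous (l : E -> R) &
    forall d v, H (d, v) -> v <= l d].
Proof.
move=> U0 cU [addH scaleH] H0 HM.
(* The cone over [U] at height [M], minus [H]. A linear [l] lying below [N] satisfies [l <= M] on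
   [U] (take [s = 1], [q = 0]) and [v <= l d] on [H] (take [s = 0]). The hypothesis on [H] is
   [nonneg_over0 N]. *)
pose N := [set p : E * R^o | exists s w q,
  [/\ 0 <= s, U w, H q & p = (s *: w - q.1, M * s - q.2 : R^o)]].
have [] := @cone_supporting_linear _ _ N.
- split.
  + move=> _ _ [s [w [q [s0 Uw Hq ->]]]] [s' [w' [q' [s0' Uw' Hq' ->]]]].
    have [w2 Uw2 w2E] := convex_set_scaled cU s0 s0' Uw Uw'.
    exists (s + s'), w2, (q + q'); split => //; [exact: addr_ge0|exact: addH|].
    congr pair; first by rewrite -w2E/= opprD addrACA.
    by rewrite /= mulrDr opprD addrACA.
  + move=> c _ c0 [s [w [q [s0 Uw Hq ->]]]].
    exists (c * s), w, (c *: q); split => //; [exact: mulr_ge0|exact: scaleH|].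
    congr pair; first by rewrite /= scalerBr scalerA.
    by rewrite /= scalerBr mulrCA.
- move=> r [s [w [[d v] [s0 Uw Hq]]]] [] /= dE ->.
  rewrite subr_ge0; apply: (HM s w) => //; move/eqP: dE.
  by rewrite eq_sym subr_eq0 => /eqP ->.
- move=> u; have [s s0 Us] := nbhs0_absorbing u U0.
  exists (M * s^-1), s^-1, (s *: u), 0.
  split => //; first by rewrite invr_ge0 ltW.
  by rewrite /= !subr0 scalerA mulVf ?gt_eqF// scale1r.
move=> l linl lN; exists l; split => //.
  apply: (linear_bounded_continuous (M := M) U0 linl) => w Uw; apply: lN.
  by exists 1, w, 0; split => //=; rewrite !subr0 scale1r mulr1.
move=> d v Hdv.
have : l (- d) <= - v.
  apply: lN; exists 0, 0, (d, v); split => //=; first exact: nbhs_singleton.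
  by rewrite scale0r mulr0 !sub0r.
have l0 := linear_at0 linl.
have := linl (-1) d 0; rewrite !scaleN1r addr0 l0 addr0 => ->.
by rewrite lerN2.
Qed.

End LocallyConvex.

(** * Compact convex sets and their extreme points *)

Lemma continuous_comp2 {T X Y Z : topologicalType} (h : X * Y -> Z)
    (f : T -> X) (g : T -> Y) :
  continuous h -> continuous f -> continuous g ->
  continuous (fun t => h (f t, g t)).
Proof.
move=> ch cf cg t; apply: (@continuous_comp _ _ _ (fun t => (f t, g t)) h).
  by apply: cvg_pair; [exact: cf|exact: cg].
exact: ch.
Qed.

Lemma compact_set_type {T : topologicalType} (K : set T) :
  compact K -> compact [set: K].
Proof.
move=> cK F PF _.
have PG : ProperFilter (set_val @ F) by exact: fmap_proper_filter.
have [|p [Kp clp]] := cK (set_val @ F) PG.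
  by apply: (@filterS _ F _ setT) => [x _|]; [exact: set_valP|exact: filterT].
exists (SigSub (mem_set Kp)); split => // A B FA [_ [[W oW <-] Wp WB]].
have [||_ [[x Ax <-] Wx]] := clp (set_val @` A) W.
- by apply: (@filterS _ F _ A) FA => x Ax; exists x.
- by apply: open_nbhs_nbhs.
by exists x; split => //; exact: WB.
Qed.

(** The members of [F] form a base of a proper filter, and a cluster point of it lies in every
    closed member. *)
Lemma compact_directed_bigcap {T : topologicalType} (F : set (set T)) :
  compact [set: T] -> F !=set0 ->
  (forall A B, F A -> F B -> exists2 C, F C & C `<=` A `&` B) ->
  (forall A, F A -> closed A /\ A !=set0) ->
  \bigcap_(A in F) A !=set0.
Proof.
move=> cT F0 Fdir Fcl.
have PG : ProperFilter (filter_from F id).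
  by apply: filter_from_proper; [apply: filter_from_filter|move=> A /Fcl[]].
have [|p [_ clp]] := cT _ PG; first exact: filterT.
exists p => A FA; apply: (Fcl A FA).1 => B Bp.
by apply: clp => //; exists A.
Qed.

Section CompactConvex.
Context {R : realType} {E : tvsType R} (K : set E).
Context (hK : compact_convex_set K).
Implicit Types (x y z : K) (S : set K) (f g : K -> R).

Local Lemma cvxK : convex_set (K : set (convex_lmodType E)).
Proof. by case: hK. Qed.

Lemma affineE f t x y z : affine f -> is_conv_comb t x y z ->
  f z = t%:num * f x + (1 - t%:num) * f y.
Proof. exact. Qed.

(** One point [z] serves both equations, so weighted points of the graph of [f] can be added within
    the cone that the graph generates. *)
Lemma exists_scaled f x y s t : affine f -> 0 <= s -> 0 <= t ->
  exists2 z, s *: \val x + t *: \val y = (s + t) *: \val z &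
    s * f x + t * f y = (s + t) * f z.
Proof.
move=> af s0 t0; have := addr_ge0 s0 t0; rewrite le_eqVlt => /predU1P[st|st].
  have [-> ->] : s = 0 /\ t = 0 by split; lra.
  by exists x; rewrite addr0 !(scale0r, mul0r) addr0.
have st1 : s / (s + t) <= 1 by rewrite ler_pdivrMr// mul1r lerDl.
have st0 : 0 <= s / (s + t) by rewrite divr_ge0// ltW.
pose r := Itv01 st0 st1.
have rE : r%:num = s / (s + t) by [].
have rE' : 1 - r%:num = t / (s + t) by rewrite rE; field; rewrite gt_eqF.
pose z : K := SigSub (cvxK r (valP x) (valP y)).
have := affineE af (erefl : is_conv_comb r x y z); rewrite rE' rE => fz.
exists z; last by rewrite fz; field; rewrite gt_eqF.
have -> : \val z = r%:num *: \val x + (1 - r%:num) *: \val y by [].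
rewrite rE' rE scalerDr !scalerA.
by congr (_ *: _ + _ *: _); field; rewrite gt_eqF.
Qed.

Lemma A_linear_shift (l : E -> R) x c :
  linear (l : E -> R^o) -> continuous (l : E -> R) ->
  A K (fun y => c + l (\val y - \val x)).
Proof.
move=> linl cl; split.
  have cval : continuous (fun y : K => \val y - \val x).
    apply: (@continuous_comp2 K E E E (fun p => p.1 - p.2) \val (cst (\val x))).
    - exact: sub_continuous.
    - exact: (@initial_continuous K E set_val).
    - exact: cst_continuous.
  move=> y; apply: (@continuousD _ R^o _ (cst c)); first exact: cst_continuous.
  exact: continuous_comp (cval y) (cl _).
move=> t y z w ->.
have -> : (\val y : convex_lmodType E) <| t |> \val z - \val x
  = t%:num *: (\val y - \val x) + ((1 - t%:num) *: (\val z - \val x) + 0).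
  rewrite addr0 !scalerBr addrACA -opprD -scalerDl.
  by rewrite [_ + (1 - _)]addrC subrK scale1r.
rewrite linl linl.
have l0 := linear_at0 linl.
by rewrite l0 -[RHS]/(t%:num * _ + (1 - t%:num) * _) /GRing.scale/=; ring.
Qed.

(** Choose a convex neighbourhood [U] of 0 that misses [d], the difference of the points. On the ray
    through [(d, 1)] the height is at most the gauge of [U], so a continuous linear [l] has
    [l d >= 1]. *)
Lemma A_separates x y : x <> y -> exists2 f, A K f & f x < f y.
Proof.
move=> xy; have [hE _ _ _] := hK.
pose d := \val y - \val x.
have d0 : d <> 0 by move/subr0_eq => /val_inj yx; exact: xy.
have nd : nbhs 0 (~` [set d]).
  apply: open_nbhs_nbhs; split; last by move=> /esym.
  exact/closed_openC/accessible_closed_set1/hausdorff_accessible.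
have [U U0 [cU Ud]] := convex_nbhs0 nd.
pose H := [set q : E * R^o | exists2 t : R, 0 <= t & q = (t *: d, t : R^o)].
have [| |s w v s0 Uw [t t0] []|l [linl cl lH]] :=
    @continuous_linear_majorant _ _ U H 1 U0 cU.
- split.
  + move=> _ _ [s s0 ->] [t t0 ->]; exists (s + t); first exact: addr_ge0.
    by rewrite scalerDl.
  + by move=> c _ c0 [s s0 ->]; exists (c * s); [exact: mulr_ge0|rewrite -scalerA].
- by exists 0; rewrite ?scale0r.
- move=> swtd ->; rewrite mul1r leNgt; apply/negP => st.
  have t1 : 0 < t by exact: le_lt_trans st.
  have dE : d = (s / t) *: w.
    by rewrite mulrC -scalerA swtd scalerA mulVf ?gt_eqF// scale1r.
  apply: (Ud d) => //; rewrite dE; apply: convex_set_shrink => //.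
  + exact: nbhs_singleton.
  + by rewrite divr_ge0//= ler_pdivrMr// mul1r ltW.
exists (fun z => 0 + l (\val z - \val x)); first exact: A_linear_shift.
rewrite !add0r subrr; have := lH d 1; rewrite -/d.
have l0 := linear_at0 linl.
by rewrite l0 => ld; rewrite (lt_le_trans ltr01)// ld//; exists 1; rewrite ?scale1r.
Qed.

Definition extremal S := forall (t : {i01 R}) x y z,
  0 < t%:num -> t%:num < 1 -> is_conv_comb t y z x -> S x -> S y /\ S z.

Lemma extremal_argmin S f x : affine f -> extremal S ->
  (forall y, S y -> f x <= f y) -> extremal (S `&` [set y | f y <= f x]).
Proof.
move=> af eS xmin t w y z t0 t1 wE [Sw fw].
have [Sy Sz] := eS t w y z t0 t1 wE Sw.
have fE := affineE af wE.
have [fy fz] := (xmin y Sy, xmin z Sz); rewrite /= in fw.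
by split; split => //=; nra.
Qed.

(** A minimal nonempty closed extremal subset of [S] is a single point: a function in A(K)
    separating two of its points would have as minimisers a smaller such set. Extremality of a
    singleton says that its point is extreme. *)
Lemma closed_extremal_has_extreme S :
  closed S -> S !=set0 -> extremal S -> exists2 x, S x & extreme_boundary K x.
Proof.
move=> cS S0 eS.
have cK : compact [set: K] by apply: compact_set_type; case: hK.
(* [Zorn_bigcup] gives maximal sets, so it is applied to the complements in [S]
   of the closed extremal sets. *)
pose P (O : set K) := [/\ closed (S `\` O), S `\` O !=set0 & extremal (S `\` O)].
have [F FP Ftot|O [[cO [x [Sx nOx]] eO] Omax]] := @Zorn_bigcup _ P.
  have [F0|F0] := pselect (F !=set0); last first.
    have -> : \bigcup_(X in F) X = set0.
      by rewrite -subset0 => v [X FX _]; apply: F0; exists X.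
    by rewrite /P setD0.
  have SE : S `\` \bigcup_(X in F) X = \bigcap_(X in F) (S `\` X).
    apply/seteqP; split => y.
      by move=> [Sy nXy] X FX; split => // Xy; apply: nXy; exists X.
    have [X0 FX0] := F0.
    move=> XSy; split; first by have [] := XSy _ FX0.
    by move=> [X FX Xy]; have [] := XSy _ FX.
  rewrite /P SE; split.
  - by apply: closed_bigI => X /FP[].
  - have := @compact_directed_bigcap _ [set S `\` X | X in F] cK.
    rewrite bigcap_image; apply.
    + exact: image_nonempty.
    + move=> _ _ [X FX <-] [Y FY <-].
      have [XY|YX] := Ftot _ _ FX FY.
      * by exists (S `\` Y); [exists Y|move=> z [Sz nYz]; split; split => // /XY].
      * by exists (S `\` X); [exists X|move=> z [Sz nXz]; split; split => // /YX].
    + by move=> _ [X /FP[cX X0 _] <-].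
  - move=> t w y z t0 t1 wE Fw.
    by split => X FX; have [_ _ eX] := FP _ FX;
      have [] := eX t w y z t0 t1 wE (Fw _ FX).
have Ox : (S `\` O) x by [].
have Oeq y : (S `\` O) y -> y = x.
  move=> Oy; apply: contrapT => /nesym /A_separates[f [cf af] fxy].
  have cSO : compact (S `\` O) by exact: subclosed_compact cK _.
  have SO0 : S `\` O !=set0 by exists x.
  have [m /set_mem Om mmin] := compact_EVT_min SO0 cSO (continuous_subspaceT cf).
  have mmin' z : (S `\` O) z -> f m <= f z by move=> Oz; apply: mmin; exact: mem_set.
  apply: (Omax (O `|` [set z | f m < f z])).
    split; first by move=> z; left.
    move=> sub; apply: Oy.2; apply: sub; right => /=.
    exact: le_lt_trans (mmin' _ Ox) fxy.
  have SE : S `\` (O `|` [set z | f m < f z]) = (S `\` O) `&` [set z | f z <= f m].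
    apply/seteqP; split => z.
    - move=> [Sz nz]; split; first by split => // Oz; apply: nz; left.
      by rewrite /= leNgt; apply/negP => fz; apply: nz; right.
    - by move=> [[Sz nOz]] /= fz; split => // -[//|/=]; rewrite ltNge fz.
  rewrite /P SE; split.
  - apply: closedI => //; apply: (@preimage_closed _ _ f [set r | r <= f m]).
    + by move=> z _; exact: cf.
    + exact: closed_le.
  - by exists m; split; [exact: Om|exact: lexx].
  - exact: extremal_argmin.
exists x; first by case: Ox.
move=> y z t t0 t1 xE; have [Oy Oz] := eO t x y z t0 t1 xE Ox.
by split; exact: Oeq.
Qed.

(** The minimisers of [f] form a nonempty closed extremal set. *)
Lemma A_min_extreme f : A K f ->
  exists2 x, extreme_boundary K x & forall y, f x <= f y.
Proof.
move=> [cf af]; have cK : compact [set: K] by apply: compact_set_type; case: hK.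
have K0 : [set: K] !=set0.
  by case: hK => _ [x Kx] _ _; exists (SigSub (mem_set Kx)).
have [m _ mmin] := compact_EVT_min K0 cK (continuous_subspaceT cf).
have [||t w y z t0 t1 wE fw|x fx ex] :=
    @closed_extremal_has_extreme (setT `&` [set y | f y <= f m]).
- apply: closedI; first exact: closedT.
  apply: (@preimage_closed _ _ f [set r | r <= f m]); last exact: closed_le.
  by move=> z _; exact: cf.
- by exists m; split; [|exact: lexx].
- apply: (@extremal_argmin setT f m _ _ _ t w y z t0 t1 wE) => // u _.
  by apply: mmin; rewrite inE.
exists x => // y; apply: (le_trans fx.2); apply: mmin; by rewrite inE.
Qed.

Lemma directed_below_one_extreme (D : set (K -> R)) :
  D `<=` A K ->
  (forall f g, D f -> D g ->
     exists2 h, D h & forall x, f x <= h x /\ g x <= h x) ->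
  (forall f, D f -> exists x, f x <= 1) ->
  (forall c, 0 < c < 1 -> D (cst c)) ->
  exists2 x, extreme_boundary K x & forall f, D f -> f x <= 1.
Proof.
move=> DA Ddir D1 Dc.
have cK : compact [set: K] by apply: compact_set_type; case: hK.
pose S := \bigcap_(f in D) [set x | f x <= 1].
have clf f : D f -> closed [set x | f x <= 1].
  move=> /DA[cf _].
  apply: (@preimage_closed _ _ f [set r | r <= 1]); last exact: closed_le.
  by move=> z _; exact: cf.
have Dhalf : D (cst 2^-1) by apply: Dc; lra.
have [|||x Sx ex] := @closed_extremal_has_extreme S; first exact: closed_bigI.
- have := @compact_directed_bigcap _ [set [set x | f x <= 1] | f in D] cK.
  rewrite bigcap_image; apply.
  + by exists [set x : K | (2^-1 : R) <= 1]; exists (cst 2^-1).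
  + move=> _ _ [f Df <-] [g Dg <-]; have [h Dh fgh] := Ddir _ _ Df Dg.
    exists [set x | h x <= 1]; first by exists h.
    by move=> x /= hx; have [fh gh] := fgh x; split; exact: le_trans hx.
  + by move=> _ [f Df <-]; split; [exact: clf|exact: D1].
- move=> t w y z t0 t1 wE Sw.
  (* Stated for one end [u] of the chord through [w], with weight [a], so that it applies to both
     ends. *)
  have main (u v : K) (a b : R) f : 0 < a -> 0 < b -> a + b = 1 ->
      (forall h, A K h -> h w = a * h u + b * h v) -> D f -> f u <= 1.
    move=> a0 b0 ab hw Df; rewrite leNgt; apply/negP => fu.
    (* A member of [D] above both [f] and a constant [c] close to 1 would exceed
       1 at [w]. *)
    pose c := Num.max 2^-1 (1 - a * (f u - 1) / 2).
    have c2 : 1 - a * (f u - 1) / 2 <= c by rewrite le_max lexx orbT.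
    have c1 : 0 < c < 1.
      rewrite lt_max gt_max; apply/andP; split; first by rewrite invr_gt0 ltr0n.
      apply/andP; split; first lra.
      by rewrite gtrBl divr_gt0// mulr_gt0// subr_gt0.
    have [h Dh fch] := Ddir _ _ Df (Dc _ c1).
    have := Sw _ Dh; rewrite /= hw; last exact: DA.
    have [fhu _] := fch u; have [_] := fch v; rewrite /= => chv.
    apply/negP; rewrite -ltNge; case/andP: c1 => _ c1.
    (* The bound [c2] on [c] gives [a * f u + b * c >= 1 + a * (f u - 1) * (1 - b / 2)], which
       exceeds 1 as [b < 1]. *)
    have : a * (f u - 1) > 0 by rewrite mulr_gt0// subr_gt0.
    have : a * f u <= a * h u by rewrite ler_wpM2l// ltW.
    have : b * c <= b * h v by rewrite ler_wpM2l// ltW.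
    nra.
  have hw h : A K h -> h w = t%:num * h y + (1 - t%:num) * h z.
    by move=> [_ /affineE]; apply.
  split => f Df /=.
  + by apply: (main y z t%:num (1 - t%:num)) => //; lra.
  + apply: (main z y (1 - t%:num) t%:num) => //; try lra.
    by move=> h /hw ->; rewrite addrC.
by exists x => // f Df; exact: Sx.
Qed.

End CompactConvex.

(** * Affine majorants at an extreme point *)

Lemma continuous_convex_mix {R : realType} {F : tvsType R} {T : topologicalType}
    (u v : T -> F) : continuous u -> continuous v ->
  continuous (fun p : T * T * R^o => p.2 *: u p.1.1 + (1 - p.2) *: v p.1.2).
Proof.
move=> cu cv.
have cfst : continuous (fun p : T * T * R^o => p.1) by move=> p; exact: cvg_fst.
have cs : continuous (fun p : T * T * R^o => p.2) by move=> p; exact: cvg_snd.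
have c1s : continuous (fun p : T * T * R^o => 1 - p.2 : R^o).
  apply: (@continuous_comp2 _ R^o R^o R^o (fun q => q.1 - q.2) (cst 1)) => //.
  - exact: sub_continuous.
  - exact: cst_continuous.
have cu' : continuous (fun p : T * T * R^o => u p.1.1).
  move=> p; apply: (@continuous_comp _ _ _ (fun p : T * T * R^o => p.1) (u \o fst)).
    exact: cfst.
  by apply: continuous_comp; [exact: cvg_fst|exact: cu].
have cv' : continuous (fun p : T * T * R^o => v p.1.2).
  move=> p; apply: (@continuous_comp _ _ _ (fun p : T * T * R^o => p.1) (v \o snd)).
    exact: cfst.
  by apply: continuous_comp; [exact: cvg_snd|exact: cv].
apply: (@continuous_comp2 _ F F F (fun q => q.1 + q.2)).
- exact: add_continuous.
- apply: (@continuous_comp2 _ R^o F F (fun q => q.1 *: q.2)) => //.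
  exact: scale_continuous.
- apply: (@continuous_comp2 _ R^o F F (fun q => q.1 *: q.2)) => //.
  exact: scale_continuous.
Qed.

Section CompactConvex.
Context {R : realType} {E : tvsType R} (K : set E).
Context (hK : compact_convex_set K).
Implicit Types (x y z : K) (f g : K -> R).

Lemma A_lincomb f g a b : A K f -> A K g -> A K (fun x => a * f x + b * g x).
Proof.
move=> [cf af] [cg ag]; split.
  move=> x; apply: (@continuousD _ R^o _ (fun x => a * f x) (fun x => b * g x)).
    by apply: continuousM; [exact: cst_continuous|exact: cf].
  by apply: continuousM; [exact: cst_continuous|exact: cg].
move=> t x y z xyz; rewrite (affineE af xyz) (affineE ag xyz).
by rewrite -[RHS]/(t%:num * _ + (1 - t%:num) * _); ring.
Qed.

Lemma A_bounded_above f : A K f -> exists M, forall x, f x <= M.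
Proof.
move=> Af; have [x _ xmin] := A_min_extreme hK (A_lincomb (-1) 0 Af Af).
by exists (f x) => y; have := xmin y; lra.
Qed.

(* The compact hypographs of [f1] and [f2] have a compact convex hull, and by
   extremality its fibre over [x] stays below [max (f1 x) (f2 x)]. *)
Lemma extreme_mix_near f1 f2 x c : A K f1 -> A K f2 ->
  extreme_boundary K x -> f1 x < c -> f2 x < c ->
  exists2 V : set E, nbhs (\val x) V & forall (s : R) y z, 0 <= s <= 1 ->
    V (s *: \val y + (1 - s) *: \val z) -> s * f1 y + (1 - s) * f2 z <= c.
Proof.
move=> [cf1 _] [cf2 _] ex f1c f2c.
have cK : compact [set: K] by apply: compact_set_type; case: hK.
pose val_mix (p : K * K * R^o) : E :=
  p.2 *: \val p.1.1 + (1 - p.2) *: \val p.1.2.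
pose f_mix (p : K * K * R^o) : R^o :=
  p.2 *: (f1 p.1.1 : R^o) + (1 - p.2) *: (f2 p.1.2 : R^o).
(* The mixtures of value at least [c]. Their image in [E] is compact, hence closed since [E] is
   Hausdorff, and [V] will be its complement; it remains to see that [x] is no such mixture. *)
pose Z := ([set: K] `*` [set: K]) `*` (`[0, 1] : set R)
  `&` f_mix @^-1` [set r | c <= r].
have cZ : compact Z.
  apply: compact_closedI.
    by apply: compact_setX; [exact: compact_setX|exact: segment_compact].
  apply: preimage_closed; last exact: closed_ge.
  by move=> p _; apply: continuous_convex_mix.
have cvZ : closed (val_mix @` Z).
  apply: compact_closed; first by case: hK.
  apply: continuous_compact => //; apply: continuous_subspaceT.
  by apply: continuous_convex_mix; exact: (@initial_continuous K E set_val).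
exists (~` (val_mix @` Z)).
  apply: open_nbhs_nbhs; split; first exact: closed_openC.
  move=> [[[y z] s] [[_ /=]]]; rewrite in_itv/= => /andP[s0 s1] cs.
  rewrite /val_mix/= => xE; move: cs; apply/negP; rewrite -ltNge /f_mix/=.
  (* Extremality concerns proper mixtures only, so [s = 0] and [s = 1] are treated apart; there [x]
     is itself the endpoint. *)
  move: s0; rewrite le_eqVlt => /predU1P[s0|s0].
    move: xE; rewrite -s0 scale0r add0r subr0 scale1r => /val_inj ->.
    by rewrite scale0r add0r scale1r.
  move: s1; rewrite le_eqVlt => /predU1P[s1|s1].
    move: xE; rewrite s1 subrr !scale0r !addr0 !scale1r => /val_inj ->.
    by [].
  have [|||-> ->] := ex y z (Itv01 (ltW s0) (ltW s1)) => //.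
  rewrite -[_ *: _]/(s * f1 x) -[(1 - s) *: _]/((1 - s) * f2 x); nra.
move=> s y z s01 nZ; rewrite leNgt; apply/negP => cs; apply: nZ.
exists (y, z, s) => //; split; last exact: ltW.
by split => //=; rewrite in_itv.
Qed.

(** Move [(x, c)] to the origin and let [H] be the cone generated by the two shifted graphs. Near
    [x] mixtures stay below [c], and elsewhere they exceed it by at most [M], so [H] lies below [M]
    times the gauge of a neighbourhood [U] of 0. A linear [l] above [H] gives the majorant
    [c + l (y - x)]. *)
Lemma extreme_common_majorant f1 f2 x c : A K f1 -> A K f2 ->
  extreme_boundary K x -> f1 x < c -> f2 x < c ->
  exists g, [/\ A K g, forall y, f1 y <= g y /\ f2 y <= g y & g x <= c].
Proof.
move=> Af1 Af2 ex f1c f2c.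
have [V Vx Vc] := extreme_mix_near Af1 Af2 ex f1c f2c.
have V0 : nbhs 0 [set u | V (\val x + u)].
  have cx : continuous (fun u : E => \val x + u).
    apply: (@continuous_comp2 E E E E (fun p => p.1 + p.2) (cst (\val x)) id).
    - exact: add_continuous.
    - exact: cst_continuous.
    - by move=> u; exact: cvg_id.
  by apply: cx; rewrite addr0.
have [U U0 [cU UV]] := convex_nbhs0 V0.
have [M1 fM1] := A_bounded_above Af1; have [M2 fM2] := A_bounded_above Af2.
(* A bound for [f1 - c] and [f2 - c], kept nonnegative because it multiplies the gauge. *)
pose M := Num.max 0 (Num.max (M1 - c) (M2 - c)).
have M0 : 0 <= M by rewrite le_max lexx.
have M1M : M1 - c <= M by rewrite !le_max lexx orbT.
have M2M : M2 - c <= M by rewrite !le_max lexx !orbT.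
pose H := [set q : E * R^o | exists (s t : R) (y z : K), [/\ 0 <= s, 0 <= t &
  q = (s *: \val y + t *: \val z - (s + t) *: \val x,
       s * (f1 y - c) + t * (f2 z - c) : R^o)]].
have [| |s w v s0 Uw|l [linl cl lH]] :=
    @continuous_linear_majorant _ _ U H M U0 cU.
- split.
  + move=> _ _ [s [t [y [z [s0 t0 ->]]]]] [s' [t' [y' [z' [s0' t0' ->]]]]].
    have [y2 yE fyE] := exists_scaled hK y y' Af1.2 s0 s0'.
    have [z2 zE fzE] := exists_scaled hK z z' Af2.2 t0 t0'.
    exists (s + s'), (t + t'), y2, z2; split; [exact: addr_ge0|exact: addr_ge0|].
    rewrite -yE -zE; congr pair => /=.
      rewrite addrACA -opprD -scalerDl; congr (_ - _ *: _); first by rewrite addrACA.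
      by rewrite addrACA.
    by rewrite -[LHS]/(_ + _ : R); nra.
  + move=> a _ a0 [s [t [y [z [s0 t0 ->]]]]].
    exists (a * s), (a * t), y, z; split; [exact: mulr_ge0|exact: mulr_ge0|].
    congr pair => /=.
      by rewrite scalerBr scalerDr !scalerA mulrDr.
    by rewrite -[LHS]/(a * _ : R); ring.
- by exists 0, 0, x, x; rewrite addr0 !scale0r !mul0r !addr0 subr0.
- move=> [s1 [t1 [y [z [s10 t10]]]]] [] swE ->.
  have fyc : f1 y - c <= M by apply: le_trans M1M; rewrite lerD2r.
  have fzc : f2 z - c <= M by apply: le_trans M2M; rewrite lerD2r.
  (* If the total weight is at most [s], the bound [M] on each term suffices. Otherwise the
     normalised mixture is [x] plus a multiple of [w] by a factor below 1, hence lies in [V], and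
     the value is at most 0. *)
  have [sts|sts] := leP (s1 + t1) s.
    apply: (@le_trans _ _ (s1 * M + t1 * M)); first by rewrite lerD// ler_wpM2l.
    by rewrite -mulrDl mulrC ler_wpM2l.
  have st0 : 0 < s1 + t1 by exact: le_lt_trans sts.
  apply: (@le_trans _ _ 0); last exact: mulr_ge0.
  pose a := s1 / (s1 + t1).
  have aE : 1 - a = t1 / (s1 + t1) by rewrite /a; field; rewrite gt_eqF.
  have a01 : 0 <= a <= 1.
    by rewrite /a divr_ge0 ?(ltW st0)//= ler_pdivrMr// mul1r lerDl.
  have : a * f1 y + (1 - a) * f2 z <= c.
    apply: Vc => //.
    have -> : a *: \val y + (1 - a) *: \val z = \val x + (s / (s1 + t1)) *: w.
      have -> : (s / (s1 + t1)) *: w = (s1 + t1)^-1 *: (s *: w).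
        by rewrite scalerA mulrC.
      rewrite swE scalerBr scalerA mulVf ?gt_eqF// scale1r.
      by rewrite [RHS]addrC subrK scalerDr !scalerA aE /a ![_^-1 * _]mulrC.
    apply: UV.
    apply: convex_set_shrink => //; first exact: nbhs_singleton.
    by rewrite divr_ge0 ?(ltW st0)//= ler_pdivrMr// mul1r ltW.
  rewrite aE /a => h.
  have -> : s1 * (f1 y - c) + t1 * (f2 z - c) =
      (s1 + t1) * (s1 / (s1 + t1) * f1 y + t1 / (s1 + t1) * f2 z - c).
    by field; rewrite gt_eqF.
  by rewrite pmulr_rle0// subr_le0.
have l0 := linear_at0 linl.
exists (fun y => c + l (\val y - \val x)); split.
- exact: A_linear_shift.
- move=> y; rewrite -!lerBlDl; split; apply: lH.
    exists 1, 0, y, y; split => //.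
    by rewrite scale0r mul0r !addr0 scale1r scale1r mul1r.
  exists 0, 1, y, y; split => //.
  by rewrite scale0r mul0r !add0r !scale1r mul1r.
- by rewrite subrr l0 addr0.
Qed.

End CompactConvex.

(** * Gauge-preserving bijections *)

Section Gauge.
Context {R : realType} {E : tvsType R} (K : set E).
Context (hK : compact_convex_set K).
Implicit Types (x y z : K) (f g : Ac K).

Lemma AcA f : A K (\val f).
Proof. by have [] := set_valP f. Qed.

Lemma Ac_gt0 f x : 0 < \val f x.
Proof. by have [_] := set_valP f. Qed.

Lemma exists_Ac (h : K -> R) : A K h -> (forall x, 0 < h x) ->
  exists f : Ac K, \val f = h.
Proof. by move=> Ah h0; exists (SigSub (mem_set (conj Ah h0 : Ac K h))). Qed.

Lemma A_scale (h : K -> R) c : A K h -> A K (fun x => c * h x).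
Proof.
move=> Ah; have := A_lincomb c 0 Ah Ah.
by congr (A K _); apply/funext => x; rewrite mul0r addr0.
Qed.

Lemma exists_Ac_scale f c : 0 < c ->
  exists g : Ac K, forall x, \val g x = c * \val f x.
Proof.
move=> c0; have [x|g gE] := exists_Ac (A_scale c (AcA f)).
  by rewrite mulr_gt0// Ac_gt0.
by exists g => x; rewrite gE.
Qed.

(** The minimum of [k - h] is attained at an extreme point. *)
Lemma le_on_extreme (h k : K -> R) : A K h -> A K k ->
  (forall x, extreme_boundary K x -> h x <= k x) -> forall x, h x <= k x.
Proof.
move=> Ah Ak hk x; have [y ey ymin] := A_min_extreme hK (A_lincomb (-1) 1 Ah Ak).
have := ymin x; have := hk y ey; lra.
Qed.

(** The gauge encodes the order relations [f <= mu * g] because its infimum is attained: every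
    admissible value is at least [f x / g x] for each [x]. An admissible value exists since [f] is
    bounded above and [g] has a positive minimum. *)
Lemma gaugeM_le f g mu : 0 < mu ->
  gaugeM f g <= mu <-> forall x, \val f x <= mu * \val g x.
Proof.
move=> mu0.
set S := [set nu : R | 0 < nu /\ forall x : K, \val f x <= nu * \val g x].
have Slb : has_lbound S by exists 0 => nu [/ltW].
split => [fg x|fg]; last exact: ge_inf.
have S0 : S !=set0.
  have [M fM] := A_bounded_above hK (AcA f).
  have [y _ ymin] := A_min_extreme hK (AcA g).
  have M0 : 0 < M by exact: lt_le_trans (Ac_gt0 f y) (fM y).
  exists (M / \val g y); split; first by rewrite divr_gt0 ?Ac_gt0.
  move=> z; apply: (le_trans (fM z)).
  by rewrite mulrAC ler_pdivlMr ?Ac_gt0// ler_wpM2l// ltW.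
rewrite -ler_pdivrMr ?Ac_gt0//; apply: le_trans fg.
by apply: lb_le_inf => // nu [_ /(_ x)]; rewrite ler_pdivrMr ?Ac_gt0.
Qed.

(** A one-sided inequality suffices: a separating function can be chosen larger at [x], and adding a
    constant makes it positive. *)
Lemma Ac_le_eq x y : (forall f, \val f x <= \val f y) -> x = y.
Proof.
move=> fxy; apply: contrapT => /nesym /(A_separates hK)[h Ah hyx].
have [m _ mmin] := A_min_extreme hK Ah.
have [|z|f fE] := @exists_Ac (fun z => 1 * h z + (1 - h m) * cst 1 z).
- by apply: A_lincomb => //; exact: (Ac_cst1 K).1.
- by have := mmin z; rewrite /cst/=; lra.
- by have := fxy f; rewrite fE; lra.
Qed.

Lemma boundary_restriction_inj f g :
  boundary_restriction f = boundary_restriction g -> f = g.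
Proof.
move=> fg; apply: val_inj; apply/funext => x.
have fgE y : extreme_boundary K y -> \val f y = \val g y.
  move=> ey; have /(congr1 (@^~ (SigSub (mem_set ey)))) := fg; exact.
apply/eqP; rewrite eq_le; apply/andP; split;
  apply: le_on_extreme => [||y /fgE ->] //; exact: AcA.
Qed.

Lemma restriction_continuous (h : K -> R) :
  continuous h -> continuous (sigL (extreme_boundary K) h).
Proof.
move=> ch x; apply: (@continuous_comp _ _ _ set_val h); last exact: ch.
exact: (@initial_continuous (extreme_boundary K) K set_val).
Qed.

End Gauge.

Section GaugeBijection.
Context {R : realType} {E E' : tvsType R} (K : set E) (K' : set E').
Context (hK : compact_convex_set K) (hK' : compact_convex_set K').

Lemma unital_gauge_bijection_sym (Phi : Ac K -> Ac K') (Phiinv : Ac K' -> Ac K) :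
  unital_gauge_bijection Phi Phiinv -> unital_gauge_bijection Phiinv Phi.
Proof.
move=> [[PK PK'] Pg P1]; split; first by split.
  by move=> f g; rewrite -Pg !PK'.
by rewrite -P1 PK.
Qed.

Lemma gauge_preserving_le (Phi : Ac K -> Ac K') mu f g :
  gauge_preserving Phi -> 0 < mu ->
  (forall x, \val (Phi f) x <= mu * \val (Phi g) x) <->
  (forall x, \val f x <= mu * \val g x).
Proof. by move=> Pg mu0; rewrite -(gaugeM_le hK') -?(gaugeM_le hK)// Pg. Qed.

Lemma exists_extreme_le (Phi : Ac K -> Ac K') (Phiinv : Ac K' -> Ac K) x :
  unital_gauge_bijection Phi Phiinv -> extreme_boundary K x ->
  exists2 x', extreme_boundary K' x' & forall f, \val (Phi f) x' <= \val f x.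
Proof.
move=> [_ Pg P1] ex.
(* The equality [g = c * f] amounts to [g <= c * f] and [f <= c^-1 * g], and [Phi] preserves
   each. *)
have PhiS c f g : 0 < c -> (forall y, \val g y = c * \val f y) ->
    forall y, \val (Phi g) y = c * \val (Phi f) y.
  move=> c0 gE y; apply/eqP; rewrite eq_le; apply/andP; split.
    by apply: (gauge_preserving_le g f Pg c0).2 => z; rewrite gE.
  rewrite mulrC -ler_pdivlMr// mulrC.
  have ci : 0 < c^-1 by rewrite invr_gt0.
  apply: (gauge_preserving_le f g Pg ci).2 => z.
  by rewrite gE mulrA mulVf ?gt_eqF// mul1r.
have PhiL f g : (forall y, \val f y <= \val g y) <->
    (forall y, \val (Phi f) y <= \val (Phi g) y).
  have [fwd bwd] := gauge_preserving_le f g Pg ltr01.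
  by split=> fg y; move: y; [have := bwd|have := fwd] => imp y;
    rewrite -[leRHS]mul1r; apply: imp => z; rewrite mul1r.
pose D := [set h : K' -> R | exists2 f : Ac K, \val f x < 1 & h = \val (Phi f)].
have [||||x' ex' Dx'] := @directed_below_one_extreme _ _ _ hK' D.
- by move=> _ [f _ ->]; exact: AcA.
- move=> _ _ [f fx ->] [g gx ->].
  (* The majorant is only known to be at most [c] at [x], while [D] asks for less than 1; hence the
     midpoint between the maximum and 1. *)
  pose c := (1 + Num.max (\val f x) (\val g x)) / 2.
  have m1 : Num.max (\val f x) (\val g x) < 1 by rewrite gt_max fx.
  have fm : \val f x <= Num.max (\val f x) (\val g x) by rewrite le_max lexx.
  have gm : \val g x <= Num.max (\val f x) (\val g x) by rewrite le_max lexx orbT.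
  have [||h [Ah fgh hx]] :=
    @extreme_common_majorant _ _ _ hK _ _ x c (AcA f) (AcA g) ex.
  + by rewrite /c; lra.
  + by rewrite /c; lra.
  have [|k kE] := exists_Ac Ah.
    by move=> y; apply: lt_le_trans (Ac_gt0 f y) _; have [] := fgh y.
  exists (\val (Phi k)); first by exists k => //; rewrite kE; rewrite /c in hx; lra.
  by move=> y; split; move: y; apply/PhiL => y; rewrite kE; have [] := fgh y.
(* If [Phi f > 1] everywhere, then [Phi 1 <= Phi f], so [1 <= f], against [f x < 1]. *)
- move=> _ [f fx ->]; apply: contrapT => nle.
  suff : \val (oneAc K) x <= \val f x by rewrite leNgt fx.
  move: x {ex fx D}; apply/PhiL => y; rewrite P1 /=.
  by rewrite leNgt; apply/negP => fy; apply: nle; exists y; exact: ltW.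
- move=> c /andP[c0 c1]; have [f fE] := exists_Ac_scale (oneAc K) c0.
  exists f; first by rewrite fE /= mulr1.
  by apply/funext => y; rewrite (PhiS _ _ _ c0 fE) P1 /= mulr1.
(* Dividing [f] by [f x + e] brings its value at [x] below 1, so its image lies in [D]. *)
exists x' => // f; apply/ler_addgt0Pr => e e0.
have fe0 : 0 < \val f x + e by rewrite addr_gt0// Ac_gt0.
have ife0 : 0 < (\val f x + e)^-1 by rewrite invr_gt0.
have [g gE] := exists_Ac_scale f ife0.
have : \val (Phi g) x' <= 1.
  by apply: Dx'; exists g => //; rewrite gE mulrC ltr_pdivrMr// mul1r ltrDl.
by rewrite (PhiS _ _ _ ife0 gE) ler_pdivrMl// mulr1.
Qed.

End GaugeBijection.

(** * Maps between the extreme boundaries *)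

Section Boundary.
Context {R : realType} {E E' : tvsType R} (K : set E) (K' : set E').
Context (hK : compact_convex_set K) (hK' : compact_convex_set K').

Lemma exists_boundary_map (Phi : Ac K -> Ac K') (Phiinv : Ac K' -> Ac K) :
  unital_gauge_bijection Phi Phiinv ->
  exists alpha : extreme_boundary K -> extreme_boundary K', forall x f,
    boundary_restriction (Phi f) (alpha x) = boundary_restriction f x.
Proof.
move=> uP; have [[PK PK'] _ _] := uP.
suff /choice[alpha alphaP] : forall x : extreme_boundary K,
    exists x' : extreme_boundary K', forall f,
    boundary_restriction (Phi f) x' = boundary_restriction f x by exists alpha.
move=> x; have [x' ex' Px'] := exists_extreme_le hK hK' uP (set_valP x).
have [y ey Py] :=
  exists_extreme_le hK' hK (unital_gauge_bijection_sym uP) ex'.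
have yx : y = \val x.
  apply: (Ac_le_eq hK) => f; apply: le_trans (Px' f).
  by have := Py (Phi f); rewrite PK.
exists (SigSub (mem_set ex')) => f.
apply/eqP; rewrite eq_le; apply/andP; split; first exact: Px'.
by have := Py (Phi f); rewrite PK yx.
Qed.

(** The extension given by the hypothesis is positive: its minimum is attained at an extreme point,
    where it is a value of [f]. *)
Lemma exists_boundary_extension
    (beta : extreme_boundary K' -> extreme_boundary K) :
  (forall f : Ac K,
    continuously_affinely_extendable (boundary_restriction f \o beta)) ->
  exists Phi : Ac K -> Ac K',
    forall f, boundary_restriction (Phi f) = boundary_restriction f \o beta.
Proof.
move=> ext; suff /choice[Phi PhiE] : forall f : Ac K, exists g : Ac K',
    boundary_restriction g = boundary_restriction f \o beta by exists Phi.
move=> f.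
have [_ [F AF FE]] := ext f; have [m em mmin] := A_min_extreme hK' AF.
have [|g gE] := exists_Ac AF; last by exists g; rewrite -FE -gE.
move=> x; apply: lt_le_trans (mmin x).
have /(congr1 (@^~ (SigSub (mem_set em)))) := FE.
by rewrite /sigL/= => ->; exact: Ac_gt0.
Qed.

End Boundary.

(** The two infima range over the same set: [f <= mu * g] can be checked on extreme points, and
    [alpha] matches those of [K] with those of [K']. *)
Lemma boundary_extension_gauge {R : realType} {E E' : tvsType R} (K : set E)
    (K' : set E') (hK : compact_convex_set K) (hK' : compact_convex_set K')
    (alpha : extreme_boundary K -> extreme_boundary K') alphainv
    (Phi : Ac K -> Ac K') :
  inverse_bijections alpha alphainv ->
  (forall f, boundary_restriction (Phi f) = boundary_restriction f \o alphainv) ->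
  gauge_preserving Phi.
Proof.
move=> [aK aK'] PhiE f g; rewrite /gaugeM; congr (inf _).
have PhiE' h (x : extreme_boundary K') :
  \val (Phi h) (\val x) = \val h (\val (alphainv x)).
  by have /(congr1 (@^~ x)) := PhiE h.
apply/seteqP; split => mu /= [mu0 fg]; split => //.
- apply: (le_on_extreme hK (AcA f) (A_scale mu (AcA g))) => x ex.
  have := fg (\val (alpha (SigSub (mem_set ex)))).
  by rewrite !PhiE' aK.
- apply: (le_on_extreme hK' (AcA (Phi f)) (A_scale mu (AcA (Phi g)))) => x ex.
  by have := fg (\val (alphainv (SigSub (mem_set ex)))); rewrite -!PhiE'.
Qed.

Section BoundaryCorrespondence.
Context {R : realType} {E E' : tvsType R} (K : set E) (K' : set E').
Context (hK : compact_convex_set K) (hK' : compact_convex_set K').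

(** The inverse of [alpha] is the boundary map built from [Phiinv]; the two cancel because the
    functions of A_c tell points apart. *)
Lemma gauge_bijection_boundary
    (Phi : Ac K -> Ac K') (Phiinv : Ac K' -> Ac K) :
  unital_gauge_bijection Phi Phiinv ->
  exists (alpha : extreme_boundary K -> extreme_boundary K')
         (alphainv : extreme_boundary K' -> extreme_boundary K),
    affine_boundary_bijection alpha alphainv /\
    determined_on_boundary Phi Phiinv alpha alphainv.
Proof.
move=> uP; have uP' := unital_gauge_bijection_sym uP.
have [[PK PK'] _ _] := uP.
have [alpha alphaP] := exists_boundary_map hK hK' uP.
have [beta betaP] := exists_boundary_map hK' hK uP'.
have aK : cancel alpha beta.
  move=> x; apply: val_inj; apply: (Ac_le_eq hK) => f.
  by have := betaP (alpha x) (Phi f); rewrite PK alphaP => /eqP;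
    rewrite eq_le => /andP[].
have bK : cancel beta alpha.
  move=> x; apply: val_inj; apply: (Ac_le_eq hK') => g.
  by have := alphaP (beta x) (Phiinv g); rewrite PK' betaP => /eqP;
    rewrite eq_le => /andP[].
have PhiE f : boundary_restriction (Phi f) = boundary_restriction f \o beta.
  by apply/funext => x /=; rewrite -[RHS]alphaP bK.
have PhiinvE g : boundary_restriction (Phiinv g) = boundary_restriction g \o alpha.
  by apply/funext => x /=; rewrite -[RHS]betaP aK.
exists alpha, beta; split; last by split.
split=> [//|f g]; rewrite -PhiE -PhiinvE.
have [[cf _] [cg _]] := (AcA (Phi f), AcA (Phiinv g)).
split; (split; first exact: restriction_continuous).
  by exists (\val (Phiinv g)); first exact: AcA.
by exists (\val (Phi f)); first exact: AcA.
Qed.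

Lemma boundary_bijection_gauge
    (alpha : extreme_boundary K -> extreme_boundary K')
    (alphainv : extreme_boundary K' -> extreme_boundary K) :
  affine_boundary_bijection alpha alphainv ->
  exists (Phi : Ac K -> Ac K') (Phiinv : Ac K' -> Ac K),
    unital_gauge_bijection Phi Phiinv /\
    determined_on_boundary Phi Phiinv alpha alphainv.
Proof.
move=> [[aK aK'] ext].
(* [ext] speaks of a pair of functions, so each half is read off with the constant 1 in the other
   place. *)
have [Phi PhiE] := exists_boundary_extension hK' (fun f => (ext f (oneAc K')).2).
have [Phiinv PhiinvE] := exists_boundary_extension hK (fun g => (ext (oneAc K) g).1).
exists Phi, Phiinv; split; last by split.
split.
+ split => [f|g].
    apply: (boundary_restriction_inj hK); rewrite PhiinvE PhiE.
    by apply/funext => x /=; rewrite aK.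
  apply: (boundary_restriction_inj hK'); rewrite PhiE PhiinvE.
  by apply/funext => x /=; rewrite aK'.
+ exact: (boundary_extension_gauge hK hK' (conj aK aK')).
+ by apply: (boundary_restriction_inj hK'); rewrite PhiE.
Qed.

End BoundaryCorrespondence.

Theorem theorem1p3 (R : realType) (E E' : tvsType R)
    (K : set E) (K' : set E')
    (hK : compact_convex_set K) (hK' : compact_convex_set K') :
  ((exists (Phi : Ac K -> Ac K') (Phiinv : Ac K' -> Ac K),
      unital_gauge_bijection Phi Phiinv) <->
   (exists (alpha : extreme_boundary K -> extreme_boundary K')
           (alphainv : extreme_boundary K' -> extreme_boundary K),
      affine_boundary_bijection alpha alphainv)) /\
  (forall (Phi : Ac K -> Ac K') (Phiinv : Ac K' -> Ac K),
     unital_gauge_bijection Phi Phiinv ->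
     exists (alpha : extreme_boundary K -> extreme_boundary K')
            (alphainv : extreme_boundary K' -> extreme_boundary K),
       affine_boundary_bijection alpha alphainv /\
       determined_on_boundary Phi Phiinv alpha alphainv) /\
  (forall (alpha : extreme_boundary K -> extreme_boundary K')
          (alphainv : extreme_boundary K' -> extreme_boundary K),
     affine_boundary_bijection alpha alphainv ->
     exists (Phi : Ac K -> Ac K') (Phiinv : Ac K' -> Ac K),
       unital_gauge_bijection Phi Phiinv /\
       determined_on_boundary Phi Phiinv alpha alphainv).
Proof.
have fwd := @gauge_bijection_boundary R E E' K K' hK hK'.
have bwd := @boundary_bijection_gauge R E E' K K' hK hK'.
split; [split|by split].
- by move=> [Phi [Phiinv /fwd[alpha [alphainv [aa _]]]]]; exists alpha, alphainv.
- by move=> [alpha [alphainv /bwd[Phi [Phiinv [uP _]]]]]; exists Phi, Phiinv.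
Qed.
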